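(* Let $r>0$ and let $P$ be the uniform distribution on the circle of radius $r$ with center $(0,0)$ in $\mathbb{R}^2$. Then the ($1$-dimensional) quantization coefficient for $P$ exists as a finite positive number and equals $\frac{\pi^2r^2}{3}$, i.e., $\lim_{n\to\infty}n^2(V_n(P)-V_\infty(P))=\frac{\pi^2r^2}{3}$.
   Context: The uniform distribution $P$ on the circle is normalized arc length: $dP=\frac{1}{2\pi}\,d\theta$ in the parametrization $\theta\mapsto(r\cos\theta,r\sin\theta)$, $0\le\theta\le2\pi$. Let $d$ be the Euclidean distance on $\mathbb{R}^2$. The $n$th (unconstrained, unconditional) quantization error of $P$ is $$V_n(P)=\inf\Big\{\int\min_{a\in\alpha}d(x,a)^2\,dP(x) : \alpha\subseteq\mathbb{R}^2,\ 1\le\mathrm{card}(\alpha)\le n\Big\},$$ and $V_\infty(P)=\lim_{n\to\infty}V_n(P)$. For $\kappa>0$, the $\kappa$-dimensional quantization coefficient of $P$ is $\lim_{n\to\infty}n^{2/\kappa}(V_n(P)-V_\infty(P))$ if it exists; here $\kappa=1$. *)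

(* Defs.v *)
From HB Require Import structures.
From mathcomp Require Import all_boot all_order all_algebra.
From mathcomp Require Import finmap.
From mathcomp Require Import all_classical all_reals all_analysis.
From mathcomp Require Import measurable_realfun.

Set Implicit Arguments.
Unset Strict Implicit.
Unset Printing Implicit Defensive.

Import Order.TTheory GRing.Theory Num.Theory.
Import numFieldTopology.Exports numFieldNormedType.Exports.

Local Open Scope fset_scope.
Local Open Scope classical_set_scope.
Local Open Scope ring_scope.
Local Open Scope ereal_scope.

(* The canonical norm of the product R * R is the sup norm, hence this
   separate definition of the Euclidean distance. *)
Definition euclidean_dist (R : realType) (x y : R * R) : R :=
  Num.sqrt ((x.1 - y.1) ^+ 2 + (x.2 - y.2) ^+ 2)%R.

(* For a nonempty alpha this is the minimum of the d(x,a)^2; for the empty set,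
   which is excluded in quantization_error, it is +oo. *)
Definition min_sqdist (R : realType) (alpha : {fset (R * R)%type})
    (x : R * R) : \bar R :=
  \big[mine/+oo]_(a <- alpha) ((euclidean_dist x a) ^+ 2)%:E.

(* The errors are kept in \bar R: no finiteness of second moments is built in,
   and the infimum is a genuine one. It is +oo for n = 0. *)
Definition quantization_error (R : realType) (P : probability (R * R)%type R)
    (n : nat) : \bar R :=
  ereal_inf [set \int[P]_x min_sqdist alpha x
            | alpha in [set alpha : {fset (R * R)%type} |
                        (1 <= #|` alpha| <= n)%N]].

Lemma quantization_error_nonincreasing (R : realType)
    (P : probability (R * R)%type R) :
  nonincreasing_seq (quantization_error P).
Proof.
move=> m n mn; apply: ereal_inf_le_tmp.
by apply: image_subset => alpha /= /andP[-> /leq_trans]; apply.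
Qed.

(* The lim below is a true limit. *)
Lemma is_cvg_quantization_error (R : realType)
    (P : probability (R * R)%type R) :
  cvgn (quantization_error P).
Proof.
exact: ereal_nonincreasing_is_cvgn (quantization_error_nonincreasing P).
Qed.

Definition quantization_error_inf (R : realType)
    (P : probability (R * R)%type R) : \bar R :=
  limn (quantization_error P).

(* The kappa-dimensional quantization coefficient of P exists and is the real
   number c. *)
Definition has_quantization_coefficient (R : realType) (kappa : R)
    (P : probability (R * R)%type R) (c : R) : Prop :=
  (n%:R `^ (2 / kappa))%:E
    * (quantization_error P n - quantization_error_inf P)
  @[n --> \oo] --> c%:E.

Definition circle_param (R : realType) (r : R) (t : measurableTypeR R) : R * R :=
  (r * cos t, r * sin t)%R.

Lemma measurable_circle_param (R : realType) (r : R) :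
  measurable_fun [set: measurableTypeR R] (circle_param r).
Proof.
apply: measurable_fun_pair; apply: measurableT_comp => //;
  apply: continuous_measurable_fun;
  [exact: continuous_cos|exact: continuous_sin].
Qed.

HB.instance Definition _ (R : realType) (r : R) :=
  isMeasurableFun.Build _ _ _ _ (circle_param r) (measurable_circle_param r).

Lemma twopi_gt0 (R : realType) : (0 < 2 * pi :> R)%R.
Proof. by rewrite mulr_gt0// pi_gt0. Qed.

(* Push-forward of dtheta / (2 pi) on [0, 2 pi]. *)
Definition uniform_circle (R : realType) (r : R) :
    probability (R * R)%type R :=
  distribution (uniform_prob (twopi_gt0 R)) (circle_param r).

(* Main.v *)
(* Put x = pi / n. For the upper bound, n equally spaced points on the circle
   and |e^(it) - e^(is)| <= |t - s| give V_n <= r^2 x^2 / 3.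
   For the lower bound, any point a of the plane has an angle phi with
   d(r e^(it), a)^2 >= (r cos x)^2 min(x, |t - phi|)^2 for t in [x, 2 pi - x]:
   the distance from r e^(it) to the ray of angle phi is r |sin (t - phi)|, or r
   when cos (t - phi) < 0, and sin u >= u cos x on [0, x].
   With c = (r x cos x)^2, the minimum over alpha is at least c minus the sum of
   the n tents c - (r cos x)^2 min(x, |t - phi_a|)^2, each of integral at most
   (4/3) c x, whence V_n >= c (1/3 - 1/n). *)
Require Import Defs.
From mathcomp Require Import all_boot all_order all_algebra.
From mathcomp Require Import finmap.
From mathcomp Require Import all_classical all_reals all_analysis.
From mathcomp Require Import measurable_realfun.
From mathcomp Require Import ring lra.

Import Order.TTheory GRing.Theory Num.Theory.
Import numFieldTopology.Exports numFieldNormedType.Exports.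

Local Open Scope classical_set_scope.
Local Open Scope ring_scope.

(** * Sine and cosine inequalities *)

Lemma mul_cos_le_sin {R : realType} (u x : R) :
  0 <= u <= x -> x <= pi / 2 -> u * cos x <= sin u.
Proof.
move=> /andP[u0 ux] xpi.
have pi0 : 0 < (pi : R) := pi_gt0 R.
(* By the mean value theorem [sin u = cos c * u] with [c] in [0, u], and cosine decreases on
   [0, pi]. *)
have [|c] := MVT_segment u0 (fun y _ => is_derive_sin y).
  by apply: continuous_subspaceT; exact: continuous_sin.
rewrite in_itv/= sin0 !subr0 => /andP[c0 cu] ->.
rewrite mulrC ler_wpM2r// leNgt ltr_cos ?in_itv/=; last 2 first.
- by apply/andP; split; lra.
- by apply/andP; split; lra.
by rewrite -leNgt; lra.
Qed.

(** Sine also vanishes at pi and at 2 pi; the sign of [cos u] excludes a neighbourhood of the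
    former, the bound on [|u|] one of the latter. For [|u|] beyond [x] this gives
    [0 <= cos u <= cos x], hence [sin u ^+ 2 >= sin x ^+ 2]. *)
Lemma sin_sqr_ge {R : realType} (x u : R) :
    0 < x <= pi / 2 -> `|u| <= 2 * pi - x -> 0 <= cos u ->
  (cos x * Num.min x `|u|) ^+ 2 <= sin u ^+ 2.
Proof.
move=> /andP[x0 xpi].
have pi0 : 0 < (pi : R) := pi_gt0 R.
have cosx0 : 0 <= cos x by apply: cos_ge0_pihalf; apply/andP; split; lra.
have sqr_cos_le_sin (v : R) : 0 <= v <= x -> (cos x * v) ^+ 2 <= sin v ^+ 2.
  move=> /andP[v0 vx].
  have := @mul_cos_le_sin _ v x; rewrite v0 vx => /(_ isT xpi) h.
  by rewrite mulrC lerXn2r ?nnegrE ?mulr_ge0// (le_trans _ h)// mulr_ge0.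
wlog u0 : u / 0 <= u => [hwlog|].
  have [/hwlog//|u0] := leP 0 u.
  move=> hu cu; rewrite -normrN -(cosN u) in hu cu *.
  by rewrite -(sqrrN (sin u)) -sinN; apply: hwlog => //; lra.
rewrite ger0_norm// => hu cu.
have [xu|ux] := leP x u; last by apply: sqr_cos_le_sin; rewrite u0 ltW.
apply: le_trans (sqr_cos_le_sin x _) _; first by rewrite lexx ltW.
suff cux : cos u <= cos x.
  have := cos2Dsin2 x; have := cos2Dsin2 u.
  have : cos u ^+ 2 <= cos x ^+ 2 by rewrite lerXn2r.
  lra.
(* The reflection of [u] to [2 * pi - u] preserves cosine and folds (pi, 2 pi - x] onto [x, pi),
   where cosine decreases. *)
wlog upi : u {u0} hu cu xu / u <= pi => [hwlog|].
  have [/hwlog|u_gt_pi] := leP u pi; first exact.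
  have <- : cos (2 * pi - u) = cos u.
    by rewrite -cosN opprB mulr_natl -(cosD2pi (u - _)) subrK.
  apply: hwlog; [lra| |lra|lra].
  by rewrite -cosN opprB mulr_natl -(cosD2pi (u - _)) subrK.
rewrite leNgt ltr_cos ?in_itv/= -?leNgt//.
- by apply/andP; split; lra.
- by apply/andP; split; lra.
Qed.

(** * Polar coordinates and distances to points of the circle *)

Lemma polar_coordinates {R : realType} (a : R * R) :
  exists rho phi : R, [/\ 0 <= rho, 0 <= phi <= 2 * pi &
    a = (rho * cos phi, rho * sin phi)].
Proof.
case: a => a1 a2; pose rho := Num.sqrt (a1 ^+ 2 + a2 ^+ 2).
have pi0 : 0 < (pi : R) := pi_gt0 R.
have rho2 : rho ^+ 2 = a1 ^+ 2 + a2 ^+ 2 by rewrite sqr_sqrtr// addr_ge0// sqr_ge0.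
have [rho0|] := eqVneq rho 0.
  exists 0, 0; rewrite !mul0r lexx; split=> //; first by lra.
  move: rho2; rewrite rho0 expr0n/= => /esym/eqP.
  by rewrite paddr_eq0 ?sqr_ge0// !sqrf_eq0 => /andP[/eqP -> /eqP ->].
move=> rhoN0; have rho_gt0 : 0 < rho by rewrite lt_neqAle eq_sym rhoN0 sqrtr_ge0.
have a1rho : -1 <= a1 / rho <= 1.
  rewrite -ler_norml normrM normfV (gtr0_norm rho_gt0) ler_pdivrMr// mul1r.
  rewrite -ler_sqr ?nnegrE ?normr_ge0 ?(ltW rho_gt0)// real_normK ?num_real// rho2.
  by rewrite lerDl sqr_ge0.
have [/andP[acos0 acospi] cosK] := acos_def a1rho.
have sinE : rho * sin (acos (a1 / rho)) = `|a2|.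
  rewrite sin_acos// -{1}(gtr0_norm rho_gt0) -sqrtr_sqr -sqrtrM ?sqr_ge0//.
  rewrite -sqrtr_sqr; congr Num.sqrt.
  by rewrite mulrBr mulr1 -exprMn mulrC divfK// rho2 addrAC subrr add0r.
(* [acos] reaches only the upper half-plane; below the axis [2 * pi - acos] keeps the angle in
   [0, 2 pi]. *)
have [a20|a20] := leP 0 a2.
- exists rho, (acos (a1 / rho)); split; [exact: ltW|lra|].
  by rewrite cosK sinE ger0_norm// mulrC divfK.
- exists rho, (2 * pi - acos (a1 / rho)); split; [exact: ltW|lra|].
  have shiftE : 2 * pi - acos (a1 / rho) = - acos (a1 / rho) + pi *+ 2.
    by rewrite mulr_natl addrC.
  rewrite shiftE cosD2pi sinD2pi cosN sinN cosK mulrN sinE ltr0_norm// opprK.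
  by rewrite mulrC divfK.
Qed.

Lemma sqr_euclidean_dist {R : realType} (x y : R * R) :
  euclidean_dist x y ^+ 2 = (x.1 - y.1) ^+ 2 + (x.2 - y.2) ^+ 2.
Proof. by rewrite sqr_sqrtr// addr_ge0// sqr_ge0. Qed.

(** Law of cosines. *)
Lemma sqr_euclidean_dist_polar {R : realType} (r rho t phi : R) :
  euclidean_dist (circle_param r t) (rho * cos phi, rho * sin phi) ^+ 2 =
  r ^+ 2 + rho ^+ 2 - 2 * r * rho * cos (t - phi).
Proof.
rewrite sqr_euclidean_dist /= cosB.
have : r ^+ 2 * (cos t ^+ 2 + sin t ^+ 2) = r ^+ 2 by rewrite cos2Dsin2 mulr1.
have : rho ^+ 2 * (cos phi ^+ 2 + sin phi ^+ 2) = rho ^+ 2.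
  by rewrite cos2Dsin2 mulr1.
lra.
Qed.

Lemma sqr_euclidean_dist_ge {R : realType} (r x : R) (a : R * R) :
    0 < r -> 0 < x <= pi / 2 ->
  exists phi : R, forall t, x <= t <= 2 * pi - x ->
    (r * (cos x * Num.min x `|t - phi|)) ^+ 2
      <= euclidean_dist (circle_param r t) a ^+ 2.
Proof.
move=> r0 xpi; have [rho [phi [rho0 phipi ->]]] := polar_coordinates a.
exists phi => t ht; rewrite sqr_euclidean_dist_polar; set u := t - phi.
have /andP[x0 _] := xpi.
have min0 : 0 <= Num.min x `|u| by rewrite le_min normr_ge0 ltW.
have [cu|cu] := leP 0 (cos u).
(* The ranges of [t] and [phi] combine here: [u] stays at least [x] away from 2 pi and -2 pi, where
   sine vanishes while cosine is positive. *)
- have hu : `|u| <= 2 * pi - x by rewrite ler_norml /u; lra.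
  rewrite exprMn.
  apply: (@le_trans _ _ (r ^+ 2 * sin u ^+ 2)).
    by rewrite ler_wpM2l ?sqr_ge0// sin_sqr_ge.
  have -> : sin u ^+ 2 = 1 - cos u ^+ 2 by rewrite -(cos2Dsin2 u); ring.
  (* The squared distance is (rho - r cos u)^2 + r^2 sin^2 u; the second term is the squared
     distance to the line of angle [phi]. *)
  have := sqr_ge0 (rho - r * cos u); nra.
(* With a negative cosine the squared distance is at least r^2, and (x cos x)^2 <= sin^2 x <= 1
   bounds the other factor. *)
- apply: (@le_trans _ _ (r ^+ 2)); last first.
    have : 0 <= r * rho * - cos u by rewrite !mulr_ge0// ?ltW// oppr_gt0.
    have := sqr_ge0 rho; lra.
  rewrite exprMn ler_piMr ?sqr_ge0//.
  apply: (@le_trans _ _ (sin x ^+ 2)); last first.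
    by rewrite -(cos2Dsin2 x) lerDr sqr_ge0.
  have pi0 : 0 < (pi : R) := pi_gt0 R.
  have cosx0 : 0 <= cos x by apply: cos_ge0_pihalf; lra.
  apply: (@le_trans _ _ ((cos x * x) ^+ 2)).
    rewrite lerXn2r ?nnegrE ?mulr_ge0 ?ler_wpM2l ?ge_min ?lexx//; exact: ltW.
  have := @sin_sqr_ge _ x x xpi; rewrite gtr0_norm// minxx; apply => //; lra.
Qed.

Lemma sin_sqr_le {R : realType} (v : R) : sin v ^+ 2 <= v ^+ 2.
Proof.
wlog v0 : v / 0 <= v => [hwlog|].
  have [/hwlog//|v0] := leP 0 v.
  by rewrite -(sqrrN v) -(sqrrN (sin v)) -sinN hwlog// oppr_ge0 ltW.
have [|c _] := MVT_segment v0 (fun y _ => is_derive_sin y).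
  by apply: continuous_subspaceT; exact: continuous_sin.
rewrite sin0 !subr0 => ->; rewrite exprMn ler_piMl ?sqr_ge0//.
Qed.

(** A chord is at most its arc: the half-angle formula makes the squared chord 4 r^2 sin^2(u / 2)
    with u = t - phi. *)
Lemma sqr_euclidean_dist_le {R : realType} (r t phi : R) :
  euclidean_dist (circle_param r t) (circle_param r phi) ^+ 2
    <= r ^+ 2 * (t - phi) ^+ 2.
Proof.
rewrite sqr_euclidean_dist_polar; set u := t - phi.
have -> : cos u = cos (u / 2) ^+ 2 - sin (u / 2) ^+ 2.
  by rewrite {1}[u]splitr cosD !expr2.
have -> : cos (u / 2) ^+ 2 = 1 - sin (u / 2) ^+ 2.
  have := cos2Dsin2 (u / 2); lra.
have := sin_sqr_le (u / 2); have := sqr_ge0 r; nra.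
Qed.

(** * Integration and measurability *)

Lemma integral_quadratic {R : realType} (a b A B phi : R) : a < b ->
  (\int[lebesgue_measure]_(t in `[a, b]) (A + B * (t - phi) ^+ 2)%:E
   = (A * (b - a) + B * ((b - phi) ^+ 3 - (a - phi) ^+ 3) / 3)%:E)%E.
Proof.
move=> ab; pose F (t : R) := A * t + B / 3 * (t - phi) ^+ 3.
have dF (t : R) : is_derive t 1 F (A + B * (t - phi) ^+ 2).
  by apply: is_derive_eq; rewrite /GRing.scale/=; field.
rewrite (@continuous_FTC2 R _ F).
- by rewrite -EFinB /F; congr _%:E; field.
- by [].
- apply: continuous_subspaceT => t; apply: cvgD; first exact: cvg_cst.
  apply: cvgMr; apply: (@continuous_comp _ _ _ (fun t => t - phi) (fun t => t ^+ 2)).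
    by apply: cvgB; [exact: cvg_id|exact: cvg_cst].
  exact: exprn_continuous.
- have Fcont : continuous F.
    by move=> t; apply/differentiable_continuous/derivable1_diffP; case: (dF t).
  split; first by move=> t _; case: (dF t).
  + exact/cvg_at_right_filter/Fcont.
  + exact/cvg_at_left_filter/Fcont.
- by move=> t _; rewrite derive1E; case: (dF t).
Qed.

Lemma measurable_min_sqdist {R : realType} (alpha : {fset (R * R)%type}) :
  measurable_fun [set: R * R] (min_sqdist alpha).
Proof.
rewrite /min_sqdist; elim: (enum_fset alpha) => [|a s ih].
  by under eq_fun do rewrite big_nil; exact: measurable_cst.
under eq_fun do rewrite big_cons.
apply: measurable_mine => //; apply/measurable_EFinP.
under eq_fun do rewrite sqr_euclidean_dist.
apply: measurable_funD; apply: measurable_funX; apply: measurable_funB => //.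
Qed.

Lemma min_sqdist_ge0 {R : realType} (alpha : {fset (R * R)%type}) (z : R * R) :
  (0 <= min_sqdist alpha z)%E.
Proof. by apply: le_bigmin => // a _; rewrite lee_fin sqr_ge0. Qed.

Lemma integral_uniform_circle {R : realType} (r : R) (f : R * R -> \bar R) :
    measurable_fun [set: R * R] f -> (forall z, 0 <= f z)%E ->
  (\int[uniform_circle r]_z f z = (2 * pi)^-1%:E *
     \int[lebesgue_measure]_(t in `[0%R, (2 * pi)%R]) f (circle_param r t))%E.
Proof.
move=> mf f0; rewrite ge0_integral_distribution//.
rewrite integral_uniform//= ?subr0//.
by apply: measurableT_comp => //; exact: measurable_circle_param.
Qed.

(** * Tents and the lower bound *)

Definition tent {R : realType} (k x phi t : R) : R :=
  k ^+ 2 * (x ^+ 2 - Num.min x `|t - phi| ^+ 2).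

Lemma measurable_tent {R : realType} (k x phi : R) :
  measurable_fun [set: R] (fun t => (tent k x phi t)%:E).
Proof.
apply/measurable_EFinP; apply: measurable_funM => //.
apply: measurable_funB => //; apply: measurable_funX.
apply: measurable_minr => //; apply: measurableT_comp => //.
exact: measurable_funB.
Qed.

Lemma tent_ge0 {R : realType} (k x phi t : R) : 0 < x ->
  0 <= tent k x phi t.
Proof.
move=> x0; rewrite /tent mulr_ge0 ?sqr_ge0// subr_ge0.
rewrite lerXn2r ?nnegrE ?ge_min ?lexx ?(ltW x0)//.
by rewrite le_min normr_ge0 ltW.
Qed.

(** The tent vanishes outside [phi - x, phi + x] and is the parabola k^2 (x^2 - (t - phi)^2) inside,
    of integral k^2 (2 x^3 - 2 x^3 / 3). *)
Lemma integral_tent_le {R : realType} (k x phi : R) (D : set R) :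
    measurable D -> 0 < x ->
  (\int[lebesgue_measure]_(t in D)
     (tent k x phi t)%:E
   <= (k ^+ 2 * x ^+ 3 * (4 / 3))%:E)%E.
Proof.
move=> mD x0; pose h (t : R) := (tent k x phi t)%:E.
have hE t : h t = (h \_ `[phi - x, phi + x]) t.
  rewrite patchE; case: ifPn => //; rewrite notin_setE/= in_itv/= => /negP.
  rewrite -ler_distl distrC -ltNge => /ltW xt.
  by rewrite /h /tent min_l ?subrr ?mulr0// distrC.
apply: (@le_trans _ _ (\int[lebesgue_measure]_t h t)%E).
  apply: ge0_subset_integral => //; first exact: measurable_tent.
  by move=> t _; rewrite lee_fin tent_ge0.
have -> : (\int[lebesgue_measure]_t h t =
    \int[lebesgue_measure]_(t in `[(phi - x)%R, (phi + x)%R]) h t)%E.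
  by rewrite [RHS]integral_mkcond; apply: eq_integral => t _; exact: hE.
have -> : (\int[lebesgue_measure]_(t in `[(phi - x)%R, (phi + x)%R]) h t =
    \int[lebesgue_measure]_(t in `[(phi - x)%R, (phi + x)%R])
      (k ^+ 2 * x ^+ 2 + (- k ^+ 2) * (t - phi) ^+ 2)%:E)%E.
  apply: eq_integral => t; rewrite inE/= in_itv/= -ler_distl => tx.
  by rewrite /h /tent min_r// real_normK ?num_real//; congr (_%:E); ring.
by rewrite integral_quadratic ?lee_fin; [lra|lra].
Qed.

(* A minimum of the d i is at least c minus the sum of all the deficits
   (c - d i)^+; this replaces the partition into Voronoi cells. *)
Lemma tent_sum_ge {R : realType} (I : Type) (s : seq I) (c : R)
    (d h : I -> R) :
    (forall i, c <= d i + h i) -> (forall i, 0 <= h i) ->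
  (c%:E <= \big[mine/+oo]_(i <- s) (d i)%:E + \sum_(i <- s) (h i)%:E)%E.
Proof.
(* The empty minimum is [+oo], so the base case is trivial. *)
move=> dh h0; elim: s => [|i s ih]; first by rewrite !big_nil addye// leey.
rewrite !big_cons addeCA.
have s0 : (0 <= \sum_(j <- s) (h j)%:E)%E by apply: sume_ge0 => j _; rewrite lee_fin.
(* If the head attains the minimum, its own [h i] makes up the deficit; otherwise the induction
   hypothesis does. The remaining terms are nonnegative. *)
rewrite /mine; case: ifPn => _.
  by rewrite addeA -EFinD -[c%:E]adde0 leeD// lee_fin addrC.
by rewrite -[c%:E]add0e leeD// lee_fin.
Qed.

Lemma integral_min_sqdist_ge {R : realType} (r : R) (n : nat)
    (alpha : {fset (R * R)%type}) :
    0 < r -> (2 <= n)%N -> (#|` alpha| <= n)%N ->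
  (((r * cos (pi / n%:R) * (pi / n%:R)) ^+ 2 * (1 / 3 - n%:R^-1))%:E
    <= \int[uniform_circle r]_z min_sqdist alpha z)%E.
Proof.
move=> r0 n2 alphan; set x := pi / n%:R; set k := r * cos x.
have pi0 : 0 < (pi : R) := pi_gt0 R.
have n0 : 0 < n%:R :> R by rewrite ltr0n (leq_trans _ n2).
have x0 : 0 < x by rewrite divr_gt0.
(* Here [2 <= n] brings [x] into the range of the angular estimate. *)
have xpi : x <= pi / 2 by rewrite ler_pM2l// lef_pV2 ?posrE// ler_nat.
have /choice[phi hphi] a := sqr_euclidean_dist_ge r x a r0 (introT andP (conj x0 xpi)).
pose h a t : R := tent k x (phi a) t.
(* Away from the ends of [0, 2 pi] no arc around a phi a wraps around, at a
   cost of relative order 1/n. *)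
pose D := `[x, 2 * pi - x].
have mm : measurable_fun [set: R] (fun t => min_sqdist alpha (circle_param r t)).
  apply: measurableT_comp; first exact: measurable_min_sqdist.
  exact: measurable_circle_param.
have tent_area_ge0 : 0 <= k ^+ 2 * x ^+ 3 * (4 / 3).
  by apply: mulr_ge0; [rewrite mulr_ge0 ?sqr_ge0 ?exprn_ge0// ltW|lra].
have lowD : (((k * x) ^+ 2 * (2 * pi - x - x) - n%:R * (k ^+ 2 * x ^+ 3 * (4 / 3)))%:E <=
   \int[lebesgue_measure]_(t in [set` D]) min_sqdist alpha (circle_param r t))%E.
  rewrite EFinB leeBlDr//.
  apply: (@le_trans _ _ (\int[lebesgue_measure]_(t in [set` D])
      (min_sqdist alpha (circle_param r t) + \sum_(a <- alpha) (h a t)%:E)))%E.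
    have -> : (((k * x) ^+ 2 * (2 * pi - x - x))%:E =
        \int[lebesgue_measure]_(t in [set` D]) ((k * x) ^+ 2)%:E)%E.
      rewrite integral_cst//= lebesgue_measure_itv/= lte_fin ifT; last by lra.
      by rewrite -EFinB -EFinM.
    apply: ge0_le_integral => //=.
    - by move=> t _; rewrite lee_fin sqr_ge0.
    - apply: emeasurable_funD; first exact: measurable_funTS.
      by apply: emeasurable_sum => a; apply: measurable_funTS; exact: measurable_tent.
    - move=> t; rewrite in_itv/= => tD.
      apply: tent_sum_ge => a; last exact: tent_ge0.
      have := hphi a t tD; rewrite mulrA -/k [(k * _) ^+ 2]exprMn /h /tent [(k * _) ^+ 2]exprMn; lra.
  rewrite ge0_integralD//=.
  - rewrite leeD2l// ge0_integral_sum//=.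
    + apply: (@le_trans _ _ (\sum_(a <- alpha) (k ^+ 2 * x ^+ 3 * (4 / 3))%:E)%E).
        by apply: lee_sum => a _; exact: integral_tent_le.
      (* There are at most [n] tents, one for each point of [alpha]. *)
      rewrite sumEFin lee_fin big_const_seq count_predT iter_addr_0 -[leLHS]mulr_natl.
      by rewrite ler_wpM2r ?ler_nat.
    + by move=> a; apply: measurable_funTS; exact: measurable_tent.
    + by move=> a t _; rewrite lee_fin tent_ge0.
  - by move=> t _; exact: min_sqdist_ge0.
  - exact: measurable_funTS.
  - by move=> t _; apply: sume_ge0 => a _; rewrite lee_fin tent_ge0.
  - by apply: emeasurable_sum => a; apply: measurable_funTS; exact: measurable_tent.
rewrite integral_uniform_circle; [|exact: measurable_min_sqdist|exact: min_sqdist_ge0].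
apply: (@le_trans _ _ ((2 * pi)^-1%:E *
    \int[lebesgue_measure]_(t in [set` D]) min_sqdist alpha (circle_param r t)))%E.
  apply: (le_trans _ (lee_wpmul2l _ lowD)); last by rewrite lee_fin invr_ge0; lra.
  (* Put c = (k x)^2. Since n x = pi, division by 2 pi turns c (2 pi - 2 x) into c (1 - 1/n) and the
     total tent area into 2 c / 3. *)
  rewrite -EFinM lee_fin; rewrite le_eqVlt; apply/orP; left; apply/eqP; rewrite /x.
  by move: (@pi R) pi0 => p p0; field; rewrite !gt_eqF.
apply: lee_wpmul2l; first by rewrite lee_fin invr_ge0; lra.
apply: ge0_subset_integral => //=.
- exact: measurable_funTS.
- by move=> t _; exact: min_sqdist_ge0.
- by move=> t; rewrite /= !in_itv/=; lra.
Qed.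

(** * Upper bound by equally spaced points *)

Lemma integral_itv_oc_split {R : realType} (f : R -> \bar R) (a b c : R) :
    measurable_fun [set: R] f -> (forall t, 0 <= f t)%E -> a <= b -> b <= c ->
  (\int[lebesgue_measure]_(t in `]a, c]) f t =
   \int[lebesgue_measure]_(t in `]a, b]) f t +
   \int[lebesgue_measure]_(t in `]b, c]) f t)%E.
Proof.
move=> mf f0 ab bc.
(* Half-open intervals make consecutive arcs disjoint. *)
rewrite (@itv_bndbnd_setU _ _ (BRight a) (BRight b) (BRight c)) ?bnd_simp//.
rewrite ge0_integral_setU//=.
- exact: measurable_funTS.
- apply/disj_setPS => t [/=]; rewrite !in_itv/=; lra.
Qed.

Lemma quantization_error_circle_le {R : realType} (r : R) (n : nat) : (0 < n)%N ->
  (quantization_error (uniform_circle r) n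
    <= (r ^+ 2 * (pi / n%:R) ^+ 2 / 3)%:E)%E.
Proof.
move=> n0; set x := pi / n%:R.
have pi0 : 0 < (pi : R) := pi_gt0 R.
have nR0 : 0 < n%:R :> R by rewrite ltr0n.
have x0 : 0 < x by rewrite divr_gt0.
(* Odd multiples of [x] are the midpoints of the [n] arcs of angular length 2 x. *)
pose alpha : {fset (R * R)%type} :=
  [fset circle_param r ((2 * k%:R + 1) * x) | k in iota 0 n]%fset.
have alphaP k : (k < n)%N -> circle_param r ((2 * k%:R + 1) * x) \in alpha.
  by move=> kn; apply: in_imfset; rewrite /= mem_iota.
apply: (@le_trans _ _ (\int[uniform_circle r]_z min_sqdist alpha z)%E).
  apply: ereal_inf_lbound; exists alpha => //=.
  apply/andP; split; last first.
    rewrite (leq_trans (leq_imfset_card _ _ _))//=.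
    by rewrite (leq_trans (size_undup _))// size_iota.
  by rewrite cardfs_gt0; apply/fset0Pn; eexists; exact: (alphaP 0%N n0).
rewrite integral_uniform_circle; [|exact: measurable_min_sqdist|exact: min_sqdist_ge0].
have mm : measurable_fun [set: R] (fun t => min_sqdist alpha (circle_param r t)).
  apply: measurableT_comp; first exact: measurable_min_sqdist.
  exact: measurable_circle_param.
(* On each arc the minimum is bounded by the squared distance to the midpoint [c] alone, and (t -
   c)^2 integrates to 2 x^3 / 3. *)
have arc k : (k < n)%N ->
    (\int[lebesgue_measure]_(t in `](2 * k%:R * x)%R, (2 * k.+1%:R * x)%R])
       min_sqdist alpha (circle_param r t) <= (r ^+ 2 * x ^+ 3 * (2 / 3))%:E)%E.
  move=> kn; set c := (2 * k%:R + 1) * x.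
  rewrite integral_itv_obnd_cbnd; last exact: measurable_funTS.
  have -> : 2 * k%:R * x = c - x by rewrite /c; ring.
  have -> : 2 * k.+1%:R * x = c + x by rewrite /c -natr1; ring.
  apply: (@le_trans _ _ (\int[lebesgue_measure]_(t in `[(c - x)%R, (c + x)%R])
      (0 + r ^+ 2 * (t - c) ^+ 2)%:E)%E).
    apply: ge0_le_integral => //=.
    - by move=> t _; exact: min_sqdist_ge0.
    - exact: measurable_funTS.
    - apply/measurable_EFinP; apply: measurable_funD => //.
      apply: measurable_funM => //; apply: measurable_funX.
      exact: measurable_funB.
    - move=> t _; apply: (@le_trans _ _
        ((euclidean_dist (circle_param r t) (circle_param r c)) ^+ 2)%:E).
        by apply: (ge_bigmin_seq _ _ xpredT) => //; exact: alphaP kn.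
      by rewrite lee_fin add0r sqr_euclidean_dist_le.
  by rewrite integral_quadratic; [rewrite lee_fin; lra|lra].
have arcs k : (k <= n)%N ->
    (\int[lebesgue_measure]_(t in `]0%R, (2 * k%:R * x)%R])
       min_sqdist alpha (circle_param r t)
     <= (k%:R * (r ^+ 2 * x ^+ 3 * (2 / 3)))%:E)%E.
  elim: k => [_|k ih kn].
    by rewrite mulr0 !mul0r set_itvoc0 integral_set0.
  have kx0 : 0 <= 2 * k%:R * x by rewrite !mulr_ge0// ltW.
  set S := r ^+ 2 * x ^+ 3 * (2 / 3) in ih arc *.
  have -> : k.+1%:R * S = k%:R * S + S by rewrite -natr1 mulrDl mul1r.
  rewrite (integral_itv_oc_split _ _ (2 * k%:R * x))//.
  - rewrite EFinD leeD//; first exact/ih/ltnW.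
    exact: arc.
  - by move=> t; exact: min_sqdist_ge0.
  - by rewrite -natr1; lra.
(* The [n] arcs fill [0, 2 pi]; n times 2 r^2 x^3 / 3, divided by 2 n x, is r^2 x^2 / 3. *)
have -> : 2 * pi = 2 * n%:R * x by rewrite /x; field; rewrite gt_eqF.
rewrite -integral_itv_obnd_cbnd; last exact: measurable_funTS.
apply: le_trans (lee_wpmul2l _ (arcs n (leqnn n))) _.
  by rewrite lee_fin invr_ge0 !mulr_ge0// ltW.
rewrite -EFinM lee_fin; rewrite le_eqVlt; apply/orP; left; apply/eqP; rewrite /x.
by move: (@pi R) pi0 => p p0; field; rewrite !gt_eqF.
Qed.

(** * Lower bound for the infimum and passage to the limit *)

Lemma quantization_error_circle_ge {R : realType} (r : R) (n : nat) :
    0 < r -> (2 <= n)%N ->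
  (((r * cos (pi / n%:R) * (pi / n%:R)) ^+ 2 * (1 / 3 - n%:R^-1))%:E
    <= quantization_error (uniform_circle r) n)%E.
Proof.
move=> r0 n2; apply: le_ereal_inf_tmp => _ [alpha /= /andP[_ alphan] <-].
exact: integral_min_sqdist_ge.
Qed.

Lemma quantization_error_ge0 {R : realType} (P : probability (R * R)%type R) n :
  (0 <= quantization_error P n)%E.
Proof.
apply: le_ereal_inf_tmp => _ [alpha _ <-].
by apply: integral_ge0 => z _; exact: min_sqdist_ge0.
Qed.

Lemma cvg_invn {R : realType} : (n%:R^-1 : R) @[n --> \oo] --> (0 : R).
Proof.
apply/gtr0_cvgV0; last exact: cvgr_idn.
by near=> n; rewrite ltr0n; near: n; exists 1%N.
Unshelve. all: by end_near. Qed.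

(** The error is squeezed between 0 and a bound of order 1/n^2. Hence the coefficient concerns n^2
    V_n itself. *)
Lemma quantization_error_inf_circle {R : realType} (r : R) :
  quantization_error_inf (uniform_circle r) = 0%E.
Proof.
apply: cvg_lim => //.
apply: (@squeeze_cvge _ _ _ _ (cst 0%E) _
  (fun n => (r ^+ 2 * (pi / n%:R) ^+ 2 / 3)%:E)).
- near=> n; rewrite quantization_error_ge0 quantization_error_circle_le//.
  by near: n; exists 1%N.
- exact: cvg_cst.
- apply: cvg_EFin; first exact: nearW.
  have -> : 0 = r ^+ 2 * (pi * 0) ^+ 2 / 3 :> R by rewrite mulr0 expr0n/= mulr0 mul0r.
  have cvg_pin : pi / n%:R @[n --> \oo] --> (pi * 0 : R).
    by apply: cvgMr; exact: cvg_invn.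
  apply: cvgMl; apply: cvgMr; rewrite !expr2; exact: cvgM.
Unshelve. all: by end_near. Qed.

Theorem theorem4p2p2 (R : realType) (r : R) (hr : 0 < r) :
  0 < pi ^+ 2 * r ^+ 2 / 3 /\
  has_quantization_coefficient 1 (uniform_circle r) (pi ^+ 2 * r ^+ 2 / 3).
Proof.
have pi0 : 0 < (pi : R) := pi_gt0 R.
split; first by rewrite divr_gt0 ?mulr_gt0 ?exprn_gt0.
rewrite /has_quantization_coefficient quantization_error_inf_circle.
(* Multiplied by n^2, the upper bound is already the constant limit; the lower bound tends to it
   because cos (pi / n) tends to 1. *)
apply: (@squeeze_cvge _ _ _ _ (fun n => ((pi * (r * cos (pi * n%:R^-1))) ^+ 2
    * (1 / 3 - n%:R^-1))%:E) _ (cst (pi ^+ 2 * r ^+ 2 / 3)%:E)); last exact: cvg_cst.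
- near=> n.
  have n2 : (2 <= n)%N by near: n; exists 2%N.
  have n0 : 0 < n%:R :> R by rewrite ltr0n (leq_trans _ n2).
  have sqrn0 : (0 <= (n%:R ^+ 2 : R)%:E)%E by rewrite lee_fin sqr_ge0.
  rewrite sube0 divr1 powR_mulrn ?ler0n//; apply/andP; split.
    apply: (le_trans _ (lee_wpmul2l sqrn0 (quantization_error_circle_ge r n hr n2))).
    rewrite -EFinM lee_fin le_eqVlt; apply/orP; left; apply/eqP.
    move: (cos _) => c; move: (@pi R) pi0 => p p0.
    by field; rewrite gt_eqF.
  apply: le_trans (lee_wpmul2l sqrn0 (quantization_error_circle_le r n (ltnW n2))) _.
  rewrite -EFinM lee_fin le_eqVlt; apply/orP; left; apply/eqP.
  by move: (@pi R) pi0 => p p0; field; rewrite gt_eqF.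
- apply: cvg_EFin; first exact: nearW.
  (* The limit is written as the lower bound with 1/n replaced by 0, so that continuity applies
     factor by factor. *)
  have -> : pi ^+ 2 * r ^+ 2 / 3 = (pi * (r * cos (pi * 0))) ^+ 2 * (1 / 3 - 0) :> R.
    by rewrite mulr0 cos0 mulr1 subr0 mul1r exprMn.
  have cvg_pin : pi / n%:R @[n --> \oo] --> (pi * 0 : R).
    by apply: cvgMr; exact: cvg_invn.
  have cvg_cos : pi * (r * cos (pi / n%:R)) @[n --> \oo] --> (pi * (r * cos (pi * 0)) : R).
    apply: cvgMr; apply: cvgMr.
    by apply: (cvg_comp _ cos cvg_pin); exact: continuous_cos.
  apply: cvgM; last by apply: cvgB; [exact: cvg_cst|exact: cvg_invn].
  by rewrite expr2; exact: cvgM.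
Unshelve. all: by end_near. Qed.
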